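(* Let $X$ be a completely regular topological space. Among hereditary collections $\alpha\subseteq\kappa(X)$, the largest one (with respect to inclusion) for which $$\mathcal{N}_\alpha(\overline{0})+\mathcal{N}_\alpha(\overline{0})\geq\mathcal{N}_\alpha(\overline{0})$$ holds is $\alpha=\Lambda^{\downarrow}(X)$. In particular, a completely regular space $X$ is infraconsonant if and only if $\kappa(X)=\Lambda^{\downarrow}(X)$.
   Context: Let $\mathcal{O}_X$ be the set of open subsets of $X$. For a family $\mathcal{A}$ of subsets of $X$, $\mathcal{O}_X(\mathcal{A})$ is the family of open subsets of $X$ containing an element of $\mathcal{A}$. A compact family on $X$ is a nonempty $\mathcal{A}\subseteq\mathcal{O}_X$ with $\mathcal{O}_X(\mathcal{A})=\mathcal{A}$ such that whenever $\mathcal{P}\subseteq\mathcal{O}_X$ and $\bigcup\mathcal{P}\in\mathcal{A}$, there is a finite $\mathcal{P}_0\subseteq\mathcal{P}$ with $\bigcup\mathcal{P}_0\in\mathcal{A}$ (the family $\mathcal{O}_X$ itself is allowed). $\kappa(X)$ is the set of all compact families on $X$. For a collection $\alpha\subseteq\kappa(X)$ such that every open subset of $X$ belongs to some member of $\alpha$ (collections $\alpha$ used to define function space topologies are assumed to have this property), $C_\alpha(X,\mathbb{R})$ is the set $C(X,\mathbb{R})$ of continuous functions $X\to\mathbb{R}$ with the topology having as subbase of open sets the sets $[\mathcal{A},U]=\{f: f^{-1}(U)\in\mathcal{A}\}$, for $\mathcal{A}\in\alpha$ and $U\subseteq\mathbb{R}$ open. $\overline{0}$ is the zero function and $\mathcal{N}_\alpha(\overline{0})$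 its neighborhood filter in $C_\alpha(X,\mathbb{R})$. The inequality $\mathcal{N}_\alpha(\overline{0})+\mathcal{N}_\alpha(\overline{0})\geq\mathcal{N}_\alpha(\overline{0})$ means: for every $V\in\mathcal{N}_\alpha(\overline{0})$ there is $W\in\mathcal{N}_\alpha(\overline{0})$ with $W+W\subseteq V$. For $\mathcal{A}\in\kappa(X)$ and $A\in\mathcal{A}$, $\mathcal{A}\downarrow A=\{U\in\mathcal{O}_X:\exists B\in\mathcal{A},\ B\subseteq A\cap U\}$; it is again a compact family. $\alpha$ is hereditary if $\mathcal{A}\downarrow A\in\alpha$ whenever $A\in\mathcal{A}\in\alpha$. Write $\mathcal{G}\vee\mathcal{G}=\{G_1\cap G_2:G_1,G_2\in\mathcal{G}\}$. $X$ is infraconsonant if for every $\mathcal{A}\in\kappa(X)$ there is $\mathcal{G}\in\kappa(X)$ with $\mathcal{G}\vee\mathcal{G}\subseteq\mathcal{A}$. A collection $\alpha\subseteq\kappa(X)$ is hereditarily self-joinable if for every $\mathcal{A}\in\alpha$ and every $A\in\mathcal{A}$ there is $\mathcal{G}\in\alpha$ with $A\in\mathcal{G}$ and $\mathcal{G}\vee\mathcal{G}\subseteq\mathcal{A}$. $\Lambda^{\downarrow}(X)$ is the largest hereditarily self-joinable subset of $\kappa(X)$ (the union of all such collections, which is again hereditarily self-joinable). *)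

(* Defs.v *)
From HB Require Import structures.
From mathcomp Require Import all_boot all_order all_algebra.
From mathcomp Require Import all_classical all_reals all_analysis.
Import Order.TTheory GRing.Theory Num.Theory.
Import numFieldNormedType.Exports.

Set Implicit Arguments.
Unset Strict Implicit.
Unset Printing Implicit Defensive.

Local Open Scope classical_set_scope.
Local Open Scope ring_scope.

Section families.
Variable X : topologicalType.
Implicit Types (A G : set_system X) (alpha : set (set_system X)).

Definition open_upset A : set_system X :=
  [set U | open U /\ exists2 B, A B & B `<=` U].

Definition kappa : set (set_system X) :=
  [set A | [/\ A !=set0, A `<=` open, open_upset A = A &
    forall P : set_system X, P `<=` open -> A (\bigcup_(U in P) U) ->
      exists P0 : set_system X,
        [/\ finite_set P0, P0 `<=` P & A (\bigcup_(U in P0) U)]]].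

Definition restr_family A (S : set X) : set_system X :=
  [set U | open U /\ exists2 B, A B & B `<=` S `&` U].

Definition self_join G : set_system X := [set G1 `&` G2 | G1 in G & G2 in G].

Definition infraconsonant : Prop :=
  forall A, kappa A -> exists2 G, kappa G & self_join G `<=` A.

(* The standing assumption on collections used to topologize C(X, R). *)
Definition covers_opens alpha : Prop :=
  forall U : set X, open U -> exists2 A, alpha A & A U.

Definition hereditary alpha : Prop :=
  forall A S, alpha A -> A S -> alpha (restr_family A S).

Definition hereditarily_self_joinable alpha : Prop :=
  alpha `<=` kappa /\
  forall A S, alpha A -> A S ->
    exists G, [/\ alpha G, G S & self_join G `<=` A].

Definition Lambda_down : set (set_system X) :=
  \bigcup_(alpha in hereditarily_self_joinable) alpha.

End families.

Arguments kappa X : clear implicits.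
Arguments infraconsonant X : clear implicits.
Arguments Lambda_down X : clear implicits.

(* C(X, R), as an alias indexed by alpha so that it can carry the
   alpha-topology instead of one of the library's function space topologies. *)
Definition Calpha (X : topologicalType) (R : realType)
  (alpha : set (set_system X)) : Type := continuousType X R.

Section Calpha_topology.
Variables (X : topologicalType) (R : realType) (alpha : set (set_system X)).

Definition Calpha_subbase : set_system (Calpha R alpha) :=
  [set [set f : continuousType X R | A (f @^-1` U)] |
     A in alpha & U in (open : set_system R)].

HB.instance Definition _ :=
  Choice.copy (Calpha R alpha) (continuousType X R).
HB.instance Definition _ :=
  isSubBaseTopological.Build (Calpha R alpha) Calpha_subbase id.

Definition Calpha_zero : Calpha R alpha := (cst 0 : continuousType X R).

Lemma Calpha_add_subproof (f g : continuousType X R) :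
  continuous (fun x => f x + g x).
Proof. by move=> x; apply: cvgD; exact: cts_fun. Qed.

Definition Calpha_add (f g : Calpha R alpha) : Calpha R alpha :=
  (mkcts (@Calpha_add_subproof f g) : continuousType X R).

Definition nbhs_zero_add_ge : Prop :=
  forall V : set (Calpha R alpha), nbhs Calpha_zero V ->
    exists2 W : set (Calpha R alpha), nbhs Calpha_zero W &
      [set Calpha_add f g | f in W & g in W] `<=` V.

End Calpha_topology.

Arguments nbhs_zero_add_ge {X} R alpha.

(* Main.v *)
Require Import Defs.
From mathcomp Require Import all_boot all_order all_algebra.
From mathcomp Require Import all_classical all_reals all_analysis.
Import numFieldNormedType.Exports.

(** The proof rests on two elementary facts about a compact family [A].

    (a) Urysohn property, [kappa_urysohn]: in a completely regular space, if
    [U] belongs to [A], then for each [r > 0] there is a continuous function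
    into [[0, 1]], equal to 1 off [U], such that the set where it is smaller
    than [r] still belongs to [A].  Each point of [U] has such a function;
    compactness of [A] keeps finitely many of them, and their product works.

    (b) Division, [kappa_quot]: for an open [N], the family of the open sets
    [U] such that [U] union [N] belongs to [A] is compact.

    If [alpha] is hereditarily self-joinable then addition is continuous at 0:
    for [G] in [alpha] such that the whole space belongs to [G] and the
    self-join of [G] is included in [A], the sum of two functions of
    [[G, (-e/2, e/2)]] lies in [[A, (-e, e)]].

    For the converse, let [alpha] be hereditary with addition continuous at 0,
    and let [S] belong to [A] in [alpha].  By (a), split [S] off with some [S']
    in [A] and an open [N] disjoint from [S'] such that [S] and [N] cover the
    space.  Let [A | S'] denote [restr_family A S']; it belongs to [alpha].
    Continuity for the neighborhood [[A | S', (-1, 1)]] of 0 gives a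
    finite intersection [G] of members of [alpha] and [r > 0] such that
    [f + g] lies in that neighborhood as soon as [f] and [g] lie in
    [[G, (-r, r)]].  Applied to the functions that (a) attaches to [G1] and
    [G2] in [G], this shows that the self-join of [G] is included in [A | S'].  This
    [G] need not contain [S], but the quotient of [G] by [N] does, and its
    self-join is included in [A] because [N] does not meet [S']
    ([self_join_quot]).
    The quotient need not belong to [alpha]; it belongs however to the closure
    of [alpha] under finite intersections and quotients ([quot_closure]), and
    the property being proved passes to that closure.  So the closure is
    hereditarily self-joinable and [alpha] is included in [Lambda_down X].

    The same splitting of [S] shows that [kappa X] is hereditarily
    self-joinable when [X] is infraconsonant. *)

Set Implicit Arguments.
Unset Strict Implicit.
Unset Printing Implicit Defensive.

Import Order.TTheory GRing.Theory Num.Theory.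
Local Open Scope classical_set_scope.
Local Open Scope ring_scope.

Lemma open_preimage (S T : topologicalType) (f : S -> T) (U : set T) :
  continuous f -> open U -> open (f @^-1` U).
Proof. by move=> /continuousP; exact. Qed.

(** * Compact families *)

Section compact_families.
Variable X : topologicalType.
Implicit Types (A G : set_system X) (alpha : set (set_system X)).
Implicit Types (U S N : set X).

Lemma kappa_open A U : kappa X A -> A U -> open U.
Proof. by case=> _ + _ _; exact. Qed.

Lemma kappa_up A U S : kappa X A -> A U -> U `<=` S -> open S -> A S.
Proof. by move=> [_ _ <- _] [oU [B AB BU]] US oS; split=> //; exists B => // x /BU/US. Qed.

Lemma kappa_setT A : kappa X A -> A setT.
Proof.
by move=> kA; have [[B AB] _ _ _] := kA; exact: (kappa_up kA AB (@subsetT _ B) openT).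
Qed.

Lemma open_upsetP G : G `<=` open ->
  (forall U S, G U -> U `<=` S -> open S -> G S) -> open_upset G = G.
Proof.
move=> oG upG; rewrite eqEsubset; split=> U.
  by move=> [oU [B GB BU]]; exact: upG GB BU oU.
by move=> GU; split; [exact: oG|exists U].
Qed.

(** If the union of [Q] belongs to [A] and each member of [Q] is included in
    some member of [P], then finitely many members of [P] cover a member of [A]; the witness [B] is the union of the corresponding
    members of [Q], so that it does not leave the union of [Q]. *)
Lemma kappa_refine A (P Q : set_system X) :
  kappa X A -> Q `<=` open -> A (\bigcup_(V in Q) V) ->
  (forall V, Q V -> exists2 U, P U & V `<=` U) ->
  exists P0 B, [/\ finite_set P0, P0 `<=` P, A B, B `<=` \bigcup_(V in Q) V
    & B `<=` \bigcup_(U in P0) U].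
Proof.
move=> [_ _ _ cA] oQ AQ QP; have [Q0 [fQ0 Q0Q AQ0]] := cA _ oQ AQ.
pose h V := xget set0 [set U | P U /\ V `<=` U].
have hP V : Q V -> P (h V) /\ V `<=` h V.
  by move=> /QP[U PU VU]; apply: (@xgetPex _ set0 [set U | P U /\ V `<=` U]); exists U.
exists (h @` Q0), (\bigcup_(V in Q0) V); split => //.
- exact: finite_image.
- by move=> _ [V /Q0Q/hP[+ _] <-].
- by move=> x [V /Q0Q QV Vx]; exists V.
- by move=> x [V Q0V Vx]; exists (h V); [exists V|apply: (hP V (Q0Q _ Q0V)).2].
Qed.

Lemma kappa_restr A S : kappa X A -> A S -> kappa X (restr_family A S).
Proof.
move=> kA AS; have oS := kappa_open kA AS; split.
- by exists S; split=> //; exists S.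
- by move=> U [].
- apply: open_upsetP => [U []//|V U [_ [B AB BV]] VU oU]; split=> //.
  by exists B => // x /BV[Sx /VU].
- move=> P oP [oUP [B AB BP]].
  have ASP : A (\bigcup_(V in [set S `&` U | U in P]) V).
    apply: (kappa_up kA AB).
      by move=> x /BP[Sx [U PU Ux]]; exists (S `&` U) => //; exists U.
    by apply: bigcup_open => _ [U PU <-]; apply: openI => //; exact: oP.
  have [||P0 [B' [fP0 P0P AB' B'S B'P]]] := kappa_refine (P := P) kA _ ASP.
  - by move=> _ [U PU <-]; apply: openI => //; exact: oP.
  - by move=> _ [U PU <-]; exists U => // x [].
  exists P0; split=> //; split; first by apply: bigcup_open => U /P0P/oP.
  exists B' => // x B'x; split; last exact: B'P.
  by have [_ [U _ <-] []] := B'S _ B'x.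
Qed.

Lemma kappa_openfam : kappa X (open : set_system X).
Proof.
split=> //; first by exists setT; exact: openT.
  exact: open_upsetP.
move=> P oP _; exists set0; split=> //; rewrite bigcup_set0; exact: open0.
Qed.

Lemma kappa_setI A G : kappa X A -> kappa X G -> kappa X (A `&` G).
Proof.
move=> kA kG; split.
- by exists setT; split; exact: kappa_setT.
- by move=> U [/(kappa_open kA)].
- apply: open_upsetP => [U [/(kappa_open kA)//]|U S [AU GU] US oS].
  by split; [exact: (kappa_up kA AU)|exact: (kappa_up kG GU)].
- move=> P oP [AP GP]; have [_ _ _ cA] := kA; have [_ _ _ cG] := kG.
  have [P1 [fP1 P1P AP1]] := cA _ oP AP; have [P2 [fP2 P2P GP2]] := cG _ oP GP.
  have P12 : P1 `|` P2 `<=` P by rewrite subUset.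
  have o12 : open (\bigcup_(U in P1 `|` P2) U) by apply: bigcup_open => U /P12/oP.
  exists (P1 `|` P2); split => //; first by rewrite finite_setU.
  rewrite bigcup_setU in o12 *.
  by split; [apply: (kappa_up kA AP1)|apply: (kappa_up kG GP2)].
Qed.

(** The quotient of [A] by [N]: the open sets that belong to [A] once
    enlarged by [N]. *)
Definition quot_family A N : set_system X := [set U | open U /\ A (U `|` N)].

Lemma kappa_quot A N : kappa X A -> open N -> kappa X (quot_family A N).
Proof.
move=> kA oN; split.
- by exists setT; split; [exact: openT|rewrite setTU; exact: kappa_setT].
- by move=> U [].
- apply: open_upsetP => [U []//|B U [oB AB] BU oU]; split=> //.
  by apply: (kappa_up kA AB); [exact: setSU|exact: openU].
- move=> P oP [oUP AP]; have [_ _ _ cA] := kA.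
  have oPN : P `|` [set N] `<=` open by move=> U [/oP // |->].
  have [|Q0 [fQ0 Q0P AQ0]] := cA _ oPN; first by rewrite bigcup_setU bigcup_set1.
  have QP : Q0 `\` [set N] `<=` P by move=> U [/Q0P[]].
  have oQ : open (\bigcup_(U in Q0 `\` [set N]) U) by apply: bigcup_open => U /QP/oP.
  exists (Q0 `\` [set N]); split=> //; first exact: finite_setD.
  split=> //; apply: (kappa_up kA AQ0); last exact: openU.
  move=> x [U Q0U Ux]; have [<-|UN] := pselect (U = N); first by right.
  by left; exists U.
Qed.

(** [A] may be restricted to [S'] in advance so that dividing by an open set
    disjoint from [S'] is harmless. *)
Lemma self_join_quot A G S' N : kappa X A -> N `&` S' = set0 ->
  self_join G `<=` restr_family A S' -> self_join (quot_family G N) `<=` A.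
Proof.
move=> kA NS' GA _ [G1 [ o1 GN1] [G2 [ o2 GN2] <-]].
have [|_ [B AB BS]] := GA ((G1 `|` N) `&` (G2 `|` N)).
  by exists (G1 `|` N) => //; exists (G2 `|` N).
apply: (kappa_up kA AB); last exact: openI.
move=> x /BS[S'x]; rewrite -setUIl => -[ //|Nx].
by have : (N `&` S') x by []; rewrite NS'.
Qed.

(** * Hereditarily self-joinable collections *)

Lemma hsj_kappa alpha :
  hereditarily_self_joinable alpha -> alpha `<=` kappa X.
Proof. by case. Qed.

Lemma hsj_Lambda alpha :
  hereditarily_self_joinable alpha -> alpha `<=` Lambda_down X.
Proof. by move=> ha A aA; exists alpha. Qed.

Lemma Lambda_hsj : hereditarily_self_joinable (Lambda_down X).
Proof.
split; first by move=> A [al [+ _]]; exact.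
move=> A S [al hal aA] AS; have [G [aG GS GA]] := hal.2 _ _ aA AS.
by exists G; split=> //; exists al.
Qed.

Lemma Lambda_covers : covers_opens (Lambda_down X).
Proof.
move=> U oU; exists (open : set_system X) => //.
exists [set (open : set_system X)] => //; split; first by move=> _ ->; exact: kappa_openfam.
move=> _ S -> oS; exists (open : set_system X); split=> //.
by move=> _ [G1 o1 [G2 o2 <-]]; exact: openI.
Qed.

Lemma Lambda_hereditary : hereditary (Lambda_down X).
Proof.
move=> A S LA AS.
pose beta := [set B | exists A S, [/\ Lambda_down X A, A S & B = restr_family A S]].
apply: (@hsj_Lambda beta); last by exists A, S.
split.
  move=> _ [A' [S' [/(hsj_kappa Lambda_hsj) kA' AS' ->]]].
  exact: kappa_restr.
move=> _ T [A' [S' [LA' AS' ->]]] [oT [B AB BST]].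
have kA' := hsj_kappa Lambda_hsj LA'.
have oS' := kappa_open kA' AS'.
have AST : A' (S' `&` T) by apply: (kappa_up kA' AB) => //; exact: openI.
have [G [LG GST GA]] := Lambda_hsj.2 _ _ LA' AST.
exists (restr_family G (S' `&` T)); split; first by exists G, (S' `&` T).
  by split=> //; exists (S' `&` T) => // x [].
move=> _ [G1 [ o1 [B1 GB1 B1G]] [G2 [ o2 [B2 GB2 B2G]] <-]].
split; first exact: openI.
exists (B1 `&` B2); first by apply: GA; exists B1 => //; exists B2.
by move=> x [/B1G[[Sx Tx] G1x] /B2G[_ G2x]].
Qed.

(** The closure of [alpha] under finite intersections (the family of all open
    sets is the intersection of none) and under quotients by open sets. *)
Inductive quot_closure alpha : set_system X -> Prop :=
| quot_closure_sub A : alpha A -> quot_closure alpha A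
| quot_closureT : quot_closure alpha open
| quot_closureI A G : quot_closure alpha A -> quot_closure alpha G ->
    quot_closure alpha (A `&` G)
| quot_closureQ A N : open N -> quot_closure alpha A ->
    quot_closure alpha (quot_family A N).

Lemma quot_closure_kappa alpha A :
  alpha `<=` kappa X -> quot_closure alpha A -> kappa X A.
Proof.
move=> ak; elim=> {A} [A /ak//||A G _ kA _ kG|A N oN _ kA].
- exact: kappa_openfam.
- exact: kappa_setI.
- exact: kappa_quot.
Qed.

Lemma quot_closure_hsj alpha : alpha `<=` kappa X ->
  (forall A S, alpha A -> A S ->
    exists G, [/\ quot_closure alpha G, G S & self_join G `<=` A]) ->
  hereditarily_self_joinable (quot_closure alpha).
Proof.
move=> ak ha; split; first by move=> A; exact: quot_closure_kappa.
move=> A S cA; elim: cA S => {A} [A aA S AS|S oS|A1 A2 _ IH1 _ IH2 S [A1S A2S]|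
                                A N oN cA IH S [oS ASN]].
- exact: ha.
- exists open; split=> //; first exact: quot_closureT.
  by move=> _ [G1 o1 [G2 o2 <-]]; exact: openI.
- have [G1 [cG1 G1S G1A]] := IH1 _ A1S; have [G2 [cG2 G2S G2A]] := IH2 _ A2S.
  exists (G1 `&` G2); split=> //; first exact: quot_closureI.
  move=> _ [U [U1 U2] [V [V1 V2] <-]].
  by split; [apply: G1A|apply: G2A]; exists U => //; exists V.
- have [G [cG GSN GA]] := IH _ ASN.
  exists (quot_family G N); split=> //; first exact: quot_closureQ.
  move=> _ [U [oU GU] [V [oV GV] <-]]; split; first exact: openI.
  by rewrite setUIl; apply: GA; exists (U `|` N) => //; exists (V `|` N).
Qed.

End compact_families.

(** * Separation by continuous functions *)

Section separation.
Variables (R : realType) (X : topologicalType).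
Hypothesis crX : completely_regular_space X.
Implicit Types (A G : set_system X).

Lemma kappa_urysohn A (U : set X) (r : R) : kappa X A -> A U -> 0 < r ->
  exists f : X -> R, [/\ continuous f, forall x, 0 <= f x <= 1,
    forall x, ~ U x -> f x = 1 & A (f @^-1` ball 0 r)].
Proof.
move=> kA AU r0; have oU := kappa_open kA AU.
pose sep (f : X -> R) := [/\ continuous f, forall x, 0 <= f x <= 1 &
  forall x, ~ U x -> f x = 1].
have o_sep f : sep f -> open (f @^-1` ball (0 : R) r).
  by case=> cf _ _; apply: open_preimage => //; exact: ball_open.
pose P := [set f @^-1` ball (0 : R) r | f in sep].
have oP : P `<=` open by move=> _ [f sf <-]; exact: o_sep.
have AP : A (\bigcup_(V in P) V).
  apply: (kappa_up kA AU); last exact: bigcup_open.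
  move=> x Ux; have /uniform_separatorP : uniform_separator [set x] (~` U).
    by apply: crX; [exact: open_closedC|exact].
  move=> /(_ R)[f [cf f01 f0 f1]].
  exists (f @^-1` ball (0 : R) r).
    exists f => //; split=> // [y|y Uy].
      by have := f01 (f y); rewrite /= in_itv /=; apply; exists y.
    by apply: f1; exists y.
  by rewrite /= (f0 (f x)); [exact: ballxx|exists x].
have [_ _ _ cA] := kA; have [P0 [/finite_seqP[s ->] sP AP0]] := cA _ oP AP.
have [f sf sU] : exists2 f, sep f & \bigcup_(V in [set` s]) V `<=` f @^-1` ball (0 : R) r.
  elim: s sP {AP0} => [_|V s IH sP].
    exists (cst 1); first by split=> // [|x]; [exact: cst_continuous|rewrite /= ler01 lexx].
    by rewrite set_nil bigcup_set0.
  have [|g [cg g01 gU] sg] := IH; first by move=> W sW; apply: sP; rewrite /= inE sW orbT.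
  have [|h [ch h01 hU] hV] := sP V; first by rewrite /= mem_head.
  exists (fun x => g x * h x).
    split=> [x|x|x Ux]; first by apply: cvgM; [exact: cg|exact: ch].
      have /andP[g0 g1] := g01 x; have /andP[h0 h1] := h01 x.
      by rewrite mulr_ge0//= mulr_ile1.
    by rewrite gU// hU// mulr1.
  move=> x [W /=]; have /andP[g0 g1] := g01 x; have /andP[h0 h1] := h01 x.
  rewrite -ball_normE /= sub0r normrN ger0_norm ?mulr_ge0// inE => /orP[/eqP ->|sW] Wx.
    move: Wx; rewrite -hV -ball_normE /= sub0r normrN ger0_norm//.
    by apply: le_lt_trans; rewrite ler_piMl.
  have : (g @^-1` ball (0 : R) r) x by apply: sg; exists W.
  rewrite -ball_normE /= sub0r normrN ger0_norm//.
  by apply: le_lt_trans; rewrite ler_piMr.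
exists f; have [cf f01 fU] := sf; split=> //.
by apply: (kappa_up kA AP0) => //; exact: o_sep.
Qed.

(** With [f] from [kappa_urysohn], take [S'] where [f < 1/2] and [N] where
    [f > 1/2]. *)
Lemma kappa_split A (S : set X) : kappa X A -> A S ->
  exists S' N, [/\ A S', open N, S `|` N = setT & N `&` S' = set0].
Proof.
move=> kA AS; have h0 : 0 < 2^-1 :> R by rewrite invr_gt0.
have [f [cf f01 fS Af]] := kappa_urysohn kA AS h0.
exists (f @^-1` ball (0 : R) 2^-1), (f @^-1` [set y | 2^-1 < y]); split=> //.
- by apply: open_preimage => //; exact: open_gt.
- rewrite -subTset => x _; have [Sx|/fS fx1] := pselect (S x); [by left|right].
  by rewrite /= fx1 invf_lt1// ltr1n.
- rewrite -subset0 => x [/= fx]; rewrite -ball_normE /= sub0r normrN.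
  by have /andP[f0 _] := f01 x; rewrite ger0_norm// => /(lt_trans fx); rewrite ltxx.
Qed.

End separation.

(** * Continuity of addition at zero *)

Section addition.
Variables (R : realType) (X : topologicalType).
Implicit Types (A G : set_system X) (alpha : set (set_system X)).

(** A filter containing the subbasic neighborhoods of [p] contains all its
    neighborhoods. *)
Lemma Calpha_nbhs_filter alpha (p : Calpha R alpha)
    (F : set_system (Calpha R alpha)) : Filter F ->
  (forall A (U : set R), alpha A -> open U -> A ((p : continuousType X R) @^-1` U) ->
    F [set f : continuousType X R | A (f @^-1` U)]) ->
  forall V, nbhs p V -> F V.
Proof.
move=> FF Fsub V; rewrite nbhsE => -[_ [[B sB <-] [C BC Cp]] sBV].
apply: filterS sBV _; apply: (@filterS _ _ _ C); first by move=> f Cf; exists C.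
have [D sD DC] := sB _ BC; rewrite -DC; apply: filter_bigI => E DE.
have /sD := DE; rewrite inE => -[A aA [U oU defE]].
move: Cp; rewrite -DC => /(_ _ DE); rewrite -defE; exact: Fsub.
Qed.

Lemma Calpha_subbase_nbhs alpha (p : Calpha R alpha) A (U : set R) :
  alpha A -> open U -> A ((p : continuousType X R) @^-1` U) ->
  nbhs p [set f : continuousType X R | A (f @^-1` U)].
Proof.
move=> aA oU Ap; apply: open_nbhs_nbhs; split=> //.
exists [set [set f : continuousType X R | A (f @^-1` U)]]; last by rewrite bigcup_set1.
move=> _ ->; apply: (@finI_from1 _ _ _ id).
by exists A => //; exists U.
Qed.

Lemma open_ball_preimage (f : continuousType X R) (r : R) :
  open (f @^-1` ball (0 : R) r).
Proof. by apply: open_preimage; [exact: cts_fun|exact: ball_open]. Qed.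

Lemma hsj_nbhs_zero_add_ge alpha :
  hereditarily_self_joinable alpha -> nbhs_zero_add_ge R alpha.
Proof.
move=> [ak ha].
pose F : set_system (Calpha R alpha) := [set V | exists2 W : set (Calpha R alpha),
  nbhs (Calpha_zero R alpha) W & [set Calpha_add f g | f in W & g in W] `<=` V].
have FF : Filter F.
  split.
  - by exists setT => //; exact: filterT.
  - move=> V1 V2 [W1 nW1 W1V] [W2 nW2 W2V]; exists (W1 `&` W2); first exact: filterI.
    move=> _ [f [f1 f2] [g [g1 g2] <-]].
    by split; [apply: W1V|apply: W2V]; exists f => //; exists g.
  - by move=> V1 V2 V12 [W nW WV]; exists W => // h /WV/V12.
apply: (@Calpha_nbhs_filter _ _ F FF) => A U aA oU.
have kA := ak _ aA.
have [U0|U0] := pselect (U 0); last first.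
  (* here the preimage of [U] by 0 is empty, so that [A] has all open sets *)
  move=> A0; exists setT; first exact: filterT.
  move=> h _ /=; apply: (kappa_up kA A0) => [x /U0//|].
  by apply: open_preimage; [exact: cts_fun|].
move=> _; have [G [aG GT GA]] := ha _ _ aA (kappa_setT kA).
have kG := ak _ aG.
have /nbhs_ballP[e /= e0 eU] : nbhs (0 : R) U by exact: open_nbhs_nbhs.
have e20 : 0 < e / 2 by rewrite divr_gt0.
exists [set f : continuousType X R | G (f @^-1` ball (0 : R) (e / 2))].
  apply: Calpha_subbase_nbhs => //; first exact: ball_open.
  apply: (kappa_up kG GT); last exact: open_ball_preimage.
  by move=> x _; exact: ballxx.
move=> _ [f Gf [g Gg <-]] /=.
have : A ((f : continuousType X R) @^-1` ball (0 : R) (e / 2)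
          `&` (g : continuousType X R) @^-1` ball (0 : R) (e / 2)).
  by apply: GA; exists (f @^-1` ball (0 : R) (e / 2)) => //;
    exists (g @^-1` ball (0 : R) (e / 2)).
move=> /(kappa_up kA); apply; last first.
  by apply: open_preimage; [exact: cts_fun|].
move=> x [/=]; rewrite -ball_normE /= !sub0r !normrN => fx gx.
apply: eU; rewrite -ball_normE /= sub0r normrN (splitr e).
by apply: le_lt_trans (ltrD fx gx); exact: ler_normD.
Qed.

Lemma nbhs_zero_quot_closure alpha (V : set (Calpha R alpha)) :
  alpha `<=` kappa X -> nbhs (Calpha_zero R alpha) V ->
  exists G (r : R), [/\ quot_closure alpha G, 0 < r &
    forall f : continuousType X R, G (f @^-1` ball (0 : R) r) -> V f].
Proof.
move=> ak.
pose F : set_system (Calpha R alpha) := [set V | exists G (r : R),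
  [/\ quot_closure alpha G, 0 < r &
  forall f : continuousType X R, G (f @^-1` ball (0 : R) r) -> V f]].
have FF : Filter F.
  split.
  - by exists open, 1; split=> //; exact: quot_closureT.
  - move=> V1 V2 [G1 [r1 [cG1 r10 GV1]]] [G2 [r2 [cG2 r20 GV2]]].
    exists (G1 `&` G2), (Num.min r1 r2); split.
    + exact: quot_closureI.
    + by rewrite lt_min r10.
    + move=> f [G1f G2f]; split; [apply: GV1|apply: GV2].
        apply: (kappa_up (quot_closure_kappa ak cG1) G1f); last exact: open_ball_preimage.
        by move=> x; apply: le_ball; rewrite ge_min lexx.
      apply: (kappa_up (quot_closure_kappa ak cG2) G2f); last exact: open_ball_preimage.
      by move=> x; apply: le_ball; rewrite ge_min lexx orbT.
  - by move=> V1 V2 V12 [G [r [cG r0 GV]]]; exists G, r; split=> // f /GV/V12.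
apply: (@Calpha_nbhs_filter _ _ F FF) => A U aA oU A0; have kA := ak _ aA.
have oU' (f : continuousType X R) : open (f @^-1` U).
  by apply: open_preimage; [exact: cts_fun|].
exists A; have [U0|U0] := pselect (U 0).
  have /nbhs_ballP[e /= e0 eU] : nbhs (0 : R) U by exact: open_nbhs_nbhs.
  exists e; split=> //; first exact: quot_closure_sub.
  by move=> f /(kappa_up kA); apply=> // x; exact: eU.
exists 1; split=> //; first exact: quot_closure_sub.
by move=> f _ /=; apply: (kappa_up kA A0) => // x /U0.
Qed.

Hypothesis crX : completely_regular_space X.

Lemma nbhs_zero_add_ge_self_join alpha A (S : set X) :
  alpha `<=` kappa X -> hereditary alpha -> nbhs_zero_add_ge R alpha ->
  alpha A -> A S ->
  exists G, [/\ quot_closure alpha G, G S & self_join G `<=` A].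
Proof.
move=> ak hal add aA AS; have kA := ak _ aA.
have [S' [N [AS' oN SN NS']]] := kappa_split R crX kA AS.
have aAS' := hal _ _ aA AS'; have kAS' := ak _ aAS'.
have [|W nW WV] :=
    add [set f : continuousType X R | restr_family A S' (f @^-1` ball (0 : R) 1)].
  apply: Calpha_subbase_nbhs => //; first exact: ball_open.
  apply: (kappa_up kAS' (kappa_setT kAS')); last exact: open_ball_preimage.
  by move=> x _; exact: ballxx.
have [G [r [cG r0 GW]]] := nbhs_zero_quot_closure ak nW.
have kG := quot_closure_kappa ak cG.
exists (quot_family G N); split; first exact: quot_closureQ.
  by split; [exact: kappa_open AS|rewrite SN; exact: kappa_setT].
apply: (self_join_quot kA NS') => _ [G1 GG1 [G2 GG2 <-]].
have [f [cf f01 fG1 Gf]] := kappa_urysohn crX kG GG1 r0.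
have [g [cg g01 gG2 Gg]] := kappa_urysohn crX kG GG2 r0.
have /WV /= : [set Calpha_add f g | f in W & g in W]
    (Calpha_add (mkcts cf : continuousType X R) (mkcts cg : continuousType X R)).
  exists (mkcts cf : continuousType X R); first exact: GW.
  by exists (mkcts cg : continuousType X R) => //; exact: GW.
move=> /(kappa_up kAS'); apply; last by apply: openI; exact: kappa_open kG _.
(* off [G1] or [G2], one of the two functions is 1 and the other nonnegative *)
move=> x /=; rewrite -ball_normE /= sub0r normrN /mkcts.
have /andP[f0 _] := f01 x; have /andP[g0 _] := g01 x.
rewrite ger0_norm ?addr_ge0// => fg1; split; apply: contrapT.
  by move=> /fG1 fx; move: fg1; rewrite fx ltNge lerDl g0.
by move=> /gG2 gx; move: fg1; rewrite gx ltNge lerDr f0.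
Qed.

Lemma infraconsonant_hsj :
  infraconsonant X -> hereditarily_self_joinable (kappa X).
Proof.
move=> infX; split=> // A S kA AS.
have [S' [N [AS' oN SN NS']]] := kappa_split R crX kA AS.
have [G kG GA] := infX _ (kappa_restr kA AS').
exists (quot_family G N); split; first exact: kappa_quot.
  by split; [exact: kappa_open AS|rewrite SN; exact: kappa_setT].
exact: self_join_quot GA.
Qed.

End addition.

Unset Implicit Arguments.

Theorem corollary3p3 (R : realType) (X : topologicalType)
    (crX : completely_regular_space X) :
  [/\ [/\ Lambda_down X `<=` kappa X, covers_opens (Lambda_down X),
          hereditary (Lambda_down X) & nbhs_zero_add_ge R (Lambda_down X)],
      (forall alpha : set (set_system X),
         alpha `<=` kappa X -> covers_opens alpha -> hereditary alpha ->
         nbhs_zero_add_ge R alpha -> alpha `<=` Lambda_down X)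
    & infraconsonant X <-> kappa X = Lambda_down X].
Proof.
split.
- split; first exact: (hsj_kappa (@Lambda_hsj X)).
  + exact: Lambda_covers.
  + exact: Lambda_hereditary.
  + exact: (hsj_nbhs_zero_add_ge (@Lambda_hsj X)).
- move=> alpha ak _ hal add A aA.
  apply: (@hsj_Lambda _ (quot_closure alpha)); last exact: quot_closure_sub.
  apply: quot_closure_hsj => // B S aB BS.
  exact: (nbhs_zero_add_ge_self_join crX ak hal add aB BS).
- split=> [infX|kL A kA].
    rewrite eqEsubset; split; last exact: (hsj_kappa (@Lambda_hsj X)).
    exact: (hsj_Lambda (infraconsonant_hsj R crX infX)).
  have LA : Lambda_down X A by rewrite -kL.
  have [G [LG _ GA]] := (@Lambda_hsj X).2 _ _ LA (kappa_setT kA).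
  by exists G => //; rewrite kL.
Qed.
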